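(* For every disc assignment function $h\in H$ there is a classical disc assignment function $h'\in H$ with $X_{h'}\subseteq X_{h}$ and $\delta_{h'}\geq\delta_{h}$.
   Context: All discs in the complex plane have finite positive radius; $r(D)$ is the radius of a disc $D$. $\mathbb{N}_0=\mathbb{N}\cup\{0\}$. Let $\mathcal{O}$ be the set of all open discs and all complements of closed discs in $\mathbb{C}$. A Swiss cheese is a pair $(\Delta,\mathcal{D})$ with $\Delta$ a closed disc and $\mathcal{D}$ a countable or finite (possibly empty) collection of open discs. A disc assignment function is a map $d:S\to\mathcal{O}$, where $S\subseteq\mathbb{N}_0$ with $0\in S$, such that $(\mathbb{C}\setminus d(0),d(S\setminus\{0\}))$ is a Swiss cheese; that is, $d(0)$ is the complement of a closed disc and $d(n)$ is an open disc for each $n\in S\setminus\{0\}$ ($S\setminus\{0\}$ may be empty, and $d$ need not be injective). Its associated Swiss cheese set is $X_d:=\mathbb{C}\setminus\bigcup_{i\in S}d(i)$. Write $\bar{d}(i)$ for the closure of $d(i)$ in $\mathbb{C}$. $d$ is classical if $\bar{d}(i)\cap\bar{d}(j)=\emptyset$ for all $i\ne j$ in $S$ and $\sum_{n\in S\setminus\{0\}}r(d(n))<\infty$. $H$ is the set of all disc assignment functions $h:S\to\mathcal{O}$ satisfying the Feinstein–Heath condition $\sum_{n\in S\setminus\{0\}}r(h(n))<r(\mathbb{C}\setminus h(0))$. For $h\in H$, $\delta_h:=r(\mathbb{C}\setminus h(0))-\sum_{n\in S\setminus\{0\}}r(h(n))>0$. *)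

(* Defs.v *)
(* R is an arbitrary realType and the complex plane is R[i]. *)
From mathcomp Require Export all_boot all_order all_algebra.
From mathcomp Require Export all_classical all_reals all_analysis.
From mathcomp Require Export complex.
From mathcomp Require Import ring lra.

Set Implicit Arguments.
Unset Strict Implicit.
Unset Printing Implicit Defensive.

Import Order.TTheory GRing.Theory Num.Theory.
Import numFieldNormedType.Exports.

Local Open Scope classical_set_scope.
Local Open Scope complex_scope.
Local Open Scope ring_scope.

(* R[i] itself carries no canonical topology; seen as a numFieldType it gets the
   topology of its modulus.  The modulus takes its values in R[i], so a real
   radius r enters comparisons as r%:C. *)
Definition cplane (R : realType) : numFieldType := R[i].

Section discs.
Context {R : realType}.
Local Notation C := (cplane R).

Definition open_disc (c : C) (r : R) : set C := ball c r%:C.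

Definition closed_disc (c : C) (r : R) : set C := closed_ball_ Num.norm c r%:C.

Definition is_open_disc (D : set C) : Prop :=
  exists c r, 0 < r /\ D = open_disc c r.

Definition is_closed_disc (D : set C) : Prop :=
  exists c r, 0 < r /\ D = closed_disc c r.

(* The radius of an open or closed disc (0 on sets that are not discs); it is
   well defined by open_disc_radius and closed_disc_radius below. *)
Definition radius (D : set C) : R :=
  xget 0 [set r | 0 < r /\
                  exists c, D = open_disc c r \/ D = closed_disc c r].

Definition discs_and_codiscs : set (set C) :=
  [set D | is_open_disc D \/ is_closed_disc (~` D)].

Definition is_swiss_cheese (Delta : set C) (D : set (set C)) : Prop :=
  [/\ is_closed_disc Delta, countable D & D `<=` is_open_disc].

End discs.

(* A partial function on nat is a total one together with its domain; the values
   outside da_dom are irrelevant. *)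
Record disc_assignment (R : realType) := DiscAssignment {
  da_dom : set nat ;
  da_fun :> nat -> set (cplane R) ;
  da_dom0 : da_dom 0%N ;
  da_codom : set_fun da_dom discs_and_codiscs da_fun ;
  da_cheese : is_swiss_cheese (~` da_fun 0%N) (da_fun @` (da_dom `\ 0%N))
}.

Section disc_assignments.
Context {R : realType}.
Implicit Type d h : disc_assignment R.

Definition swiss_cheese_set d : set (cplane R) :=
  ~` \bigcup_(i in da_dom d) d i.

(* The sum of the radii is over indices, so repeated discs are counted with
   multiplicity; being a sum of nonnegative terms it always exists in \bar R,
   and it is +oo exactly when the series diverges. *)
Definition sum_radii d : \bar R :=
  (\esum_(n in da_dom d `\ 0%N) (radius (d n))%:E)%E.

Definition classical d : Prop :=
  (forall i j, da_dom d i -> da_dom d j -> i <> j ->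
     closure (d i) `&` closure (d j) = set0) /\
  (sum_radii d < +oo)%E.

Definition feinstein_heath d : Prop :=
  (sum_radii d < (radius (~` d 0%N))%:E)%E.

Definition delta h : \bar R :=
  ((radius (~` h 0%N))%:E - sum_radii h)%E.

End disc_assignments.

Section disc_radius.
Context {R : realType}.
Local Notation C := (cplane R).

Let normC_real (s : R) : `|s%:C : C| = `|s|%:C.
Proof. by rewrite normc_def /= expr0n /= addr0 sqrtr_sqr. Qed.

Let radius_mono (c c' : C) (r r' : R) : 0 < r -> 0 < r' ->
  open_disc c r `<=` closed_disc c' r' -> r <= r'.
Proof.
move=> r0 r'0 sub; rewrite leNgt; apply/negP => lt_r'r.
pose s : R := (r + r') / 2.
have [r's rs] : r' < s /\ s < r by rewrite /s; split; lra.
have s0 : 0 < s by exact: lt_trans r's.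
have h1 : closed_disc c' r' (c + s%:C).
  apply: sub; rewrite /open_disc -ball_normE /= opprD addrA subrr add0r normrN.
  by rewrite normC_real gtr0_norm // ltcR.
have h2 : closed_disc c' r' (c - s%:C).
  apply: sub; rewrite /open_disc -ball_normE /= opprB addrC subrK.
  by rewrite normC_real gtr0_norm // ltcR.
have : `|(s + s)%:C : C| <= (r' + r')%:C.
  rewrite !rmorphD /=.
  have -> : s%:C + s%:C = (c' - (c - s%:C)) - (c' - (c + s%:C)) :> C.
    by rewrite !opprD !opprK !addrA; ring.
  by apply: le_trans (ler_normB _ _) _; exact: lerD h2 h1.
rewrite normC_real lecR ger0_norm; last by rewrite addr_ge0 // ltW.
by rewrite leNgt ltrD.
Qed.

Let sub_oo (c : C) r : open_disc c r `<=` closed_disc c r.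
Proof. by move=> z; rewrite /open_disc -ball_normE /= => /ltW. Qed.

Let radius_eq (D : set C) (c : C) (r : R) : 0 < r ->
  D = open_disc c r \/ D = closed_disc c r -> radius D = r.
Proof.
move=> r0 Dr; rewrite /radius.
case: xgetP => [t _ [t0 [c' Dt]]|/(_ r) []]; last by split=> //; exists c.
have bd (a : C) x : D = open_disc a x \/ D = closed_disc a x ->
    open_disc a x `<=` D /\ D `<=` closed_disc a x.
  by case=> ->; split;
    [exact: subset_refl|exact: sub_oo|exact: sub_oo|exact: subset_refl].
have [rD Dr'] := bd _ _ Dr; have [tD Dt'] := bd _ _ Dt.
apply/eqP; rewrite eq_le; apply/andP; split.
  by apply: (@radius_mono c' c) => //; exact: subset_trans tD Dr'.
by apply: (@radius_mono c c') => //; exact: subset_trans rD Dt'.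
Qed.

Lemma open_disc_radius (c : C) (r : R) : 0 < r -> radius (open_disc c r) = r.
Proof. by move=> r0; apply: (@radius_eq _ c) => //; left. Qed.

Lemma closed_disc_radius (c : C) (r : R) :
  0 < r -> radius (closed_disc c r) = r.
Proof. by move=> r0; apply: (@radius_eq _ c) => //; right. Qed.

End disc_radius.

(* Main.v *)
Require Import Defs.
From mathcomp Require Import ring lra.

Set Implicit Arguments.
Unset Strict Implicit.
Unset Printing Implicit Defensive.

(** Two open discs of radii [s] and [t] whose closures meet lie in an open disc
    of radius [s + t]; likewise, if the closure of an open disc of radius [t]
    meets the closure of the complement of a closed disc of radius [r > t], the
    union of the two lies in the complement of a closed disc of radius [r - t].
    Counting the complement of a closed disc of radius [r] as having signed
    radius [- r], both say that touching discs merge at the cost of adding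
    their signed radii ([gdisc_merge]).  So merging shrinks the Swiss cheese set
    and does not decrease delta, and it remains to merge until nothing touches.

    Infinitely many merges are handled through blocks: a block is a set [B] of
    indices together with one (generalized) disc that contains all [h n],
    [n \in B], and whose signed radius is at most the sum of theirs.  Blocks are
    ordered by growth of the index set and of the disc.  Increasing sequences of
    blocks have upper bounds, because the signed radii are bounded and the
    centres then converge ([nested_limit], [block_limit]).  The total radius of
    the indices of a block is bounded and strictly increases at each merge with
    a block of new indices, so the Brezis-Browder ordering principle
    ([exists_maximal]) yields, inside any set [A] of available indices, a block
    whose disc touches the disc of no block made of the remaining indices
    ([maximal_block]): otherwise the two could be merged, their index sets being
    disjoint.

    This maximality of a single block is so strong that a greedy choice
    finishes the proof ([block_partition]): take a maximal block containing 0,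
    then one containing 1 among the indices left over (if 1 is left), and so on.
    Every later block uses indices available when an earlier one was chosen, so
    closures of distinct discs are disjoint, and since the blocks partition the
    indices, summing the radius bounds gives the inequality on delta. *)

Import Order.TTheory GRing.Theory Num.Theory.
Import numFieldNormedType.Exports.

Local Open Scope classical_set_scope.
Local Open Scope complex_scope.
Local Open Scope ring_scope.

(** * An ordering principle *)

(** The Brezis-Browder principle.  Choosing at each step an element whose value
    is at least halfway to the supremum of what is reachable, the reachable
    gain tends to 0, so nothing above an upper bound of the sequence can have
    a larger value. *)
Lemma exists_maximal (R : realType) (T : Type) (le : T -> T -> Prop)
    (m : T -> R) (M : R) :
  (forall x, le x x) -> (forall x y z, le x y -> le y z -> le x z) ->
  (forall x y, le x y -> m x <= m y) -> (forall x, m x <= M) ->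
  (forall u : nat -> T, (forall n, le (u n) (u n.+1)) ->
     exists z, forall n, le (u n) z) ->
  forall x, exists2 z, le x z & forall y, le z y -> m y <= m z.
Proof.
move=> lexx letr mono mM ub x0.
(* The gain of the step from x to y is at least half of the possible gain. *)
have step x : exists y, le x y /\
    forall w, le x w -> m w <= m y + (m y - m x).
  pose V := m @` [set y | le x y].
  have supV : has_sup V.
    by split; [exists (m x), x|exists M => _ [y _ <-]].
  have mV w : le x w -> m w <= sup V.
    by move=> xw; apply: sup_upper_bound => //; exists w.
  have [xV|Vx] := ltP (m x) (sup V).
    have e0 : 0 < (sup V - m x) / 2 by lra.
    have [_ [y xy <-] yV] := sup_adherent e0 supV.
    by exists y; split=> // w /mV; lra.
  by exists x; split=> // w /mV; lra.
have [f fP] := choice step.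
pose u n := iter n f x0.
have [z zP] := ub u (fun n => (fP (u n)).1).
exists z; first exact: (zP 0%N).
move=> y zy; rewrite leNgt; apply/negP => lt_zy.
(* If m y exceeds m z by e, every step gains at least e, against the bound. *)
pose e := m y - m z.
have e0 : 0 < e by rewrite /e; lra.
have grow n : m x0 + e *+ n <= m (u n).
  elim: n => [|n IH]; first by rewrite mulr0n addr0.
  have h1 := (fP (u n)).2 y (letr _ _ _ (zP n) zy).
  have h2 := mono _ _ (zP n.+1).
  rewrite mulrSr /u iterS -/(u n).
  rewrite /u iterS -/(u n) in h2.
  rewrite /e in IH *; lra.
have [N lt_N] : exists N : nat, (m z - m x0) / e < N%:R.
  exists (Num.bound `|(m z - m x0) / e|).
  exact: le_lt_trans (ler_norm _) (archi_boundP (normr_ge0 _)).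
move: lt_N; rewrite ltr_pdivrMr // mulr_natl.
by have := grow N; have := mono _ _ (zP N); lra.
Qed.

(** * Discs of signed radius *)

Section plane.
Context {R : realType}.
Local Notation C := (cplane R).
Implicit Types (a c z w : C) (r s t : R).

(** The modulus of [R[i]] takes its values in [R[i]]; [dist] is its real-valued
    version, on which the linear arithmetic procedures work. *)
Definition dist z w : R := complex.Re (`|z - w| : R[i]).

Lemma distE z w : `|z - w| = (dist z w)%:C.
Proof. by rewrite /dist RRe_real // normr_real. Qed.

Lemma dist_ge0 z w : 0 <= dist z w.
Proof. by rewrite -lecR -distE normr_ge0. Qed.

Lemma distC z w : dist z w = dist w z.
Proof. by rewrite /dist distrC. Qed.

Lemma distxx z : dist z z = 0.
Proof. by rewrite /dist subrr normr0. Qed.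

Lemma dist_triangle w z a : dist z a <= dist z w + dist w a.
Proof. by rewrite -lecR rmorphD /= -!distE ler_distD. Qed.

Lemma dist_le_ReIm z w : dist z w <=
  `|complex.Re z - complex.Re w| + `|complex.Im z - complex.Im w|.
Proof.
rewrite -lecR -distE normc_def lecR.
have -> : complex.Re (z - w) = complex.Re z - complex.Re w.
  by case: z w => [? ?] [? ?].
have -> : complex.Im (z - w) = complex.Im z - complex.Im w.
  by case: z w => [? ?] [? ?].
move: (_ - _) => x; move: (_ - _) => y.
rewrite -[leRHS]ger0_norm ?addr_ge0// -[leRHS]sqrtr_sqr; apply: ler_wsqrtr.
rewrite -(real_normK (num_real x)) -(real_normK (num_real y)).
have := mulr_ge0 (normr_ge0 x) (normr_ge0 y); nra.
Qed.

Lemma Re_le_dist z w : complex.Re z - complex.Re w <= dist z w.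
Proof.
apply: le_trans (ler_norm _) _; rewrite -lecR -distE.
by apply: le_trans (normc_ge_Re _); case: z w => [? ?] [? ?].
Qed.

Lemma Im_le_dist z w : complex.Im z - complex.Im w <= dist z w.
Proof.
apply: le_trans (ler_norm _) _.
rewrite -lecR -distE normc_def lecR -[leLHS]sqrtr_sqr; apply: ler_wsqrtr.
by case: z w => [? ?] [? ?] /=; rewrite lerDr sqr_ge0.
Qed.

(** The hypothesis says that the discs of centres [c n] and signed radii [s n]
    are nested.  Adding [s] to either coordinate of [c] makes it nondecreasing,
    so the centres converge with the radii, and the inequalities pass to the
    limit. *)
Lemma nested_limit (c : nat -> C) (s : nat -> R) M :
  (forall n, dist (c n) (c n.+1) <= s n.+1 - s n) -> (forall n, s n <= M) ->
  exists a t, (forall n, dist (c n) a <= t - s n) /\ t <= M.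
Proof.
move=> cs sM.
have csD n m : (n <= m)%N -> dist (c n) (c m) <= s m - s n.
  elim: m => [|m IH]; first by rewrite leqn0 => /eqP->; rewrite distxx subrr.
  rewrite leq_eqVlt => /predU1P[->|]; first by rewrite distxx subrr.
  rewrite ltnS => /IH; have := cs m; have := dist_triangle (c m) (c n) (c m.+1).
  lra.
have cvs : cvgn s.
  apply: nondecreasing_is_cvgn; last by exists M => _ [n _ <-].
  move=> n m nm; have := csD _ _ nm; have := dist_ge0 (c n) (c m); lra.
(* p is a coordinate function; p \o c + s is nondecreasing and bounded. *)
have cvp (p : C -> R) : (forall z w, p z - p w <= dist z w) -> cvgn (p \o c).
  move=> pd.
  have : cvgn (fun n => p (c n) + s n).
    apply: nondecreasing_is_cvgn.
      by move=> n m nm; have := csD _ _ nm; have := pd (c n) (c m); lra.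
    exists (p (c 0%N) + M + M - s 0%N) => _ [n _ <-].
    have := pd (c n) (c 0%N); have := csD 0%N n isT; rewrite distC.
    have := sM n; lra.
  move=> /is_cvgB/(_ cvs).
  suff -> : p \o c = (fun n => p (c n) + s n) - s by [].
  by apply/funext => n; rewrite /= !fctE addrK.
have cvRe := cvp _ Re_le_dist; have cvIm := cvp _ Im_le_dist.
set x := limn (@complex.Re R \o c) in cvRe.
set y := limn (@complex.Im R \o c) in cvIm.
exists ((x +i* y) : R[i]), (limn s); split; last first.
  by apply: limr_le => //; near=> n; exact: sM.
move=> n.
pose v m := s m - s n + (`|complex.Re (c m) - x| + `|complex.Im (c m) - y|).
have vl : v @ \oo --> limn s - s n + (`|x - x| + `|y - y|).
  apply: cvgD; first by apply: cvgB => //; exact: cvg_cst.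
  by apply: cvgD; apply: cvg_norm; apply: cvgB => //; exact: cvg_cst.
have -> : limn s - s n = limn v.
  by rewrite (cvg_lim _ vl) // !subrr normr0 !addr0.
apply: limr_ge; first by apply/cvg_ex; eexists; exact: vl.
near=> m.
have nm : (n <= m)%N by near: m; exact: nbhs_infty_ge.
apply: le_trans (dist_triangle (c m) _ _) _.
by apply: lerD; [exact: csD|exact: dist_le_ReIm].
Unshelve. all: by end_near. Qed.

(** With [b] set, the radius [s] is meant to be negative and the set is the
    complement of the closed disc of radius [- s].  With this sign, growth of a
    disc and of a complement are the same inequality (see [gdisc_subset]). *)
Definition gdisc (b : bool) c s : set C :=
  if b then ~` closed_disc c (- s) else open_disc c s.

Lemma open_discE c r z : open_disc c r z = (dist c z < r).
Proof. by rewrite /open_disc -ball_normE /= distE ltcR. Qed.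

Lemma closed_discE c r z : closed_disc c r z = (dist c z <= r).
Proof. by rewrite /closed_disc /closed_ball_ /= distE lecR. Qed.

Lemma gdiscE b c s z : gdisc b c s z <->
  if b then - s < dist c z else dist c z < s.
Proof.
case: b; rewrite /gdisc /= ?open_discE// closed_discE.
by rewrite ltNge; split=> /negP.
Qed.

Lemma gdisc_subset b c s a t : dist c a <= t - s ->
  gdisc b c s `<=` gdisc b a t.
Proof.
move=> ca z /gdiscE cz; apply/gdiscE; case: b cz => cz.
  have := dist_triangle a c z; lra.
have := dist_triangle c a z; rewrite (distC a c); lra.
Qed.

Lemma closure_gdisc b c s z : closure (gdisc b c s) z ->
  if b then - s <= dist c z else dist c z <= s.
Proof.
case: b => Dz; rewrite leNgt; apply/negP => zs.
  have : nbhs z (open_disc c (- s)).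
    apply: open_nbhs_nbhs; split; first exact: ball_open.
    by rewrite open_discE.
  by move=> /Dz[w [/gdiscE cw]]; rewrite open_discE; lra.
have : nbhs z (open_disc z (dist c z - s)).
  apply: open_nbhs_nbhs; split; first exact: ball_open.
  by rewrite open_discE distxx subr_gt0.
move=> /Dz[w [/gdiscE cw]]; rewrite open_discE.
have := dist_triangle w c z; rewrite (distC w z); lra.
Qed.

Lemma dist_affine c a t : dist c (c + t%:C * (a - c)) = `|t| * dist c a.
Proof.
apply: (@complexI R); rewrite rmorphM /= -!distE opprD addNKr normrN normrM.
by rewrite normc_def /= expr0n /= addr0 sqrtr_sqr distrC.
Qed.

(** The case where signed radii add up exactly is tangency, which dictates the
    centre [w]: between the two centres when [b] is unset; on the line of the
    two centres, away from [a] at distance [t] of [c], when [b] is set.  If the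
    closures overlap more, the same choices leave some room. *)
Lemma gdisc_merge b c s a t :
  (if b then s + t < 0 else 0 < s) -> 0 < t ->
  closure (gdisc b c s) `&` closure (gdisc false a t) !=set0 ->
  exists2 w, dist c w <= t & gdisc false a t `<=` gdisc b w (s + t).
Proof.
move=> bs t0 [z [/closure_gdisc cz /closure_gdisc az]].
have h1 := dist_triangle a c z; have h2 := dist_triangle z c a.
have ca := dist_ge0 c a; rewrite (distC z a) in h2.
case: b bs cz => bs cz; last first.
  (* With this weight, w is at distance at most t of c and s of a. *)
  pose p := t / (s + t).
  have p01 : 0 <= p <= 1.
    by rewrite /p divr_ge0 ?ler_pdivrMr ?mul1r ?lerDr /=; lra.
  have pst : p * (s + t) = t by rewrite /p divfK // gt_eqF; lra.
  exists (c + p%:C * (a - c)).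
    by rewrite dist_affine ger0_norm; nra.
  apply: gdisc_subset.
  have -> : c + p%:C * (a - c) = a + (1 - p)%:C * (c - a).
    by rewrite rmorphB rmorph1; ring.
  by rewrite dist_affine (distC a c) ger0_norm; nra.
(* The centres differ, as the disc around a reaches the circle around c and is
   smaller: this is where s + t < 0 is used. *)
have d0 : 0 < dist c a by lra.
pose p := t / dist c a.
have pE : p * dist c a = t by rewrite /p divfK // gt_eqF.
have p0 : 0 <= p by rewrite /p divr_ge0; lra.
exists (c + (- p)%:C * (a - c)).
  by rewrite dist_affine normrN ger0_norm // pE.
move=> x /gdiscE ax; apply/gdiscE.
have := dist_triangle x a (c + (- p)%:C * (a - c)).
have {1}-> : c + (- p)%:C * (a - c) = a + (1 + p)%:C * (c - a).
  by rewrite rmorphN rmorphD rmorph1; ring.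
rewrite dist_affine ger0_norm ?(distC a c) ?(distC x); last lra.
rewrite mulrDl pE mul1r; lra.
Qed.

Lemma radius_ge0 (D : set C) : 0 <= radius D.
Proof. by rewrite /radius; case: xgetP => // r _ [/ltW]. Qed.

End plane.

(** * Blocks of discs *)

Lemma esum_subset (R : realType) (T : choiceType) (A B : set T)
    (a : T -> \bar R) : (forall x, 0 <= a x)%E -> A `<=` B ->
  (\esum_(i in A) a i <= \esum_(i in B) a i)%E.
Proof.
move=> a0 AB; rewrite (esumID A B) // (setIidr AB) leeDl //.
exact: esum_ge0.
Qed.

Section blocks.
Context {R : realType}.
Variable h : disc_assignment R.
Hypothesis hFH : feinstein_heath h.
Local Notation C := (cplane R).
Local Notation S := (da_dom h).
Implicit Types (A B : set nat) (c : C) (s : R).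

(** The index 0 is left out: it carries the complement of a closed disc, whose
    negative contribution is accounted for separately in [block]. *)
Definition mass B : R := fine (\esum_(n in B `\ 0%N) (radius (h n))%:E)%E.

Lemma massE B : B `<=` S ->
  (\esum_(n in B `\ 0%N) (radius (h n))%:E)%E = (mass B)%:E.
Proof.
move=> BS; rewrite /mass fineK // ge0_fin_numE; last first.
  by apply: esum_ge0 => n _; rewrite lee_fin radius_ge0.
apply: le_lt_trans (lt_trans hFH (ltry _)).
apply: esum_subset => [n|n []]; first by rewrite lee_fin radius_ge0.
by split; [exact: BS|].
Qed.

Lemma mass_lt : mass S < radius (~` h 0%N).
Proof. by rewrite -lte_fin -massE. Qed.

Lemma massS A B : A `<=` B -> B `<=` S -> mass A <= mass B.
Proof.
move=> AB BS; rewrite -lee_fin -!massE //; last exact: subset_trans BS.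
apply: esum_subset => [n|n []]; first by rewrite lee_fin radius_ge0.
by split; [exact: AB|].
Qed.

Lemma massU A B : A `|` B `<=` S -> A `&` B = set0 ->
  mass (A `|` B) = mass A + mass B.
Proof.
move=> ABS AB0; have [AS BS] : A `<=` S /\ B `<=` S by rewrite -subUset.
have ABn n : A n -> B n -> False.
  by move=> An Bn; suff : set0 n by []; rewrite -AB0.
apply: EFin_inj; rewrite EFinD -!massE //.
rewrite (esumID A); last by move=> n _; rewrite lee_fin radius_ge0.
by congr (_ + _)%E; congr esum; apply/seteqP; split=> n /=;
  have := ABn n; tauto.
Qed.

Lemma disc_at0 : exists2 c, 0 < radius (~` h 0%N) &
  h 0%N = gdisc true c (- radius (~` h 0%N)).
Proof.
have [[c [r [r0 e]]] _ _] := da_cheese h.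
exists c; rewrite e closed_disc_radius //.
by rewrite /gdisc opprK -e setCK.
Qed.

Lemma disc_at n : S n -> n <> 0%N -> exists2 c, 0 < radius (h n) &
  h n = gdisc false c (radius (h n)).
Proof.
move=> Sn n0; have [_ _ /(_ (h n))] := da_cheese h.
case; first by exists n.
by move=> c [r [r0 e]]; exists c; rewrite e open_disc_radius.
Qed.

Lemma mass1 n : S n -> n <> 0%N -> mass [set n] = radius (h n).
Proof.
move=> Sn n0; apply: EFin_inj; rewrite -massE; last by move=> _ ->.
have -> : [set n] `\ 0%N = [set n].
  by apply/seteqP; split=> [m []//|m ->]; split.
by rewrite esum_set1 // lee_fin radius_ge0.
Qed.

Lemma mass10 : mass [set 0%N] = 0.
Proof. by rewrite /mass setDv esum_set0. Qed.

Lemma mass_gt0 B n : B `<=` S -> B n -> n <> 0%N -> 0 < mass B.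
Proof.
move=> BS Bn n0; have [_ r0 _] := disc_at (BS _ Bn) n0.
apply: lt_le_trans r0 _; rewrite -mass1 //; last exact: BS.
by apply: massS => // _ ->.
Qed.

(** The flag [b] tells whether the block contains the index 0, hence whether its
    disc is the complement of a closed disc. *)
Definition block (b : bool) B c s :=
  [/\ B `<=` S, B 0%N <-> b, (if b then s < 0 else 0 < s),
      (forall n, B n -> h n `<=` gdisc b c s) &
      s <= mass B - (if b then radius (~` h 0%N) else 0)].

Lemma block1 n : S n -> exists c s, block (n == 0%N) [set n] c s.
Proof.
case: eqVneq => [-> S0|/eqP n0 Sn].
  have [c r0 e] := disc_at0.
  exists c, (- radius (~` h 0%N)); split.
  - by move=> m ->.
  - by [].
  - by rewrite oppr_lt0.
  - by move=> m ->; rewrite -e.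
  - by rewrite mass10 add0r.
have [c r0 e] := disc_at Sn n0.
exists c, (radius (h n)); split.
- by move=> m ->.
- by split=> // e0; case: n0.
- by [].
- by move=> m ->; rewrite -e.
- by rewrite mass1 // subr0.
Qed.

Lemma block_merge b A B c s a t : block b A c s -> block false B a t ->
  A `&` B = set0 ->
  closure (gdisc b c s) `&` closure (gdisc false a t) !=set0 ->
  exists2 w, dist c w <= t & block b (A `|` B) w (s + t).
Proof.
move=> [AS Ab bs Ac sA] [BS Bb t0 Bc tB] AB0 meet.
have ABS : A `|` B `<=` S by move=> n [/AS|/BS].
have mAB := massU ABS AB0.
have st : s + t <= mass (A `|` B) - (if b then radius (~` h 0%N) else 0).
  by rewrite mAB; lra.
have bst : if b then s + t < 0 else 0 < s.
  case: b bs st {Ab Ac sA meet} => // _ st.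
  by have := mass_lt; have := massS ABS (@subset_refl _ S); lra.
have [w cw aw] := gdisc_merge bst t0 meet.
exists w => //; split=> //.
- by split=> [[/Ab//|/Bb//]|/Ab]; left.
- by case: b bs bst {Ab Ac sA meet st aw}; lra.
- move=> n [/Ac|/Bc] hn; last exact: subset_trans aw.
  by apply: subset_trans hn _; apply: gdisc_subset; lra.
Qed.

(** The bound on the signed radii needed for the limit of the discs is the one
    attached to the union of the index sets.  That bound is negative when [b] is
    set, by the Feinstein-Heath condition, so the limit is again the complement
    of a closed disc of positive radius. *)
Lemma block_limit b (B : nat -> set nat) (c : nat -> C) (s : nat -> R) :
  (forall n, block b (B n) (c n) (s n)) ->
  (forall n, B n `<=` B n.+1) ->
  (forall n, dist (c n) (c n.+1) <= s n.+1 - s n) ->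
  exists a t, (forall n, dist (c n) a <= t - s n) /\
    block b (\bigcup_n B n) a t.
Proof.
move=> bl incB nest.
have BS : \bigcup_n B n `<=` S.
  by move=> k [n _]; have [+ _ _ _ _] := bl n; apply.
pose M := mass (\bigcup_n B n) - (if b then radius (~` h 0%N) else 0).
have sM n : s n <= M.
  have [_ _ _ _ /le_trans] := bl n; apply; rewrite lerD2r.
  by apply: massS => //; exact: bigcup_sup.
have [a [t [ca tM]]] := nested_limit nest sM.
exists a, t; split=> //; split=> //.
- split=> [[n _]|b1]; first by have [_ + _ _ _] := bl n; move=> /[apply].
  by exists 0%N => //; have [_ + _ _ _] := bl 0%N; move=> ->.
- have [_ _ + _ _] := bl 0%N; have := ca 0%N; have := dist_ge0 (c 0%N) a.
  have := massS BS (@subset_refl _ S); have := mass_lt.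
  by move: tM; rewrite /M; case: b {bl sM M}; lra.
- move=> k [n _ Bk]; have [_ _ _ /(_ k Bk) hk _] := bl n.
  by apply: subset_trans hk _; exact: gdisc_subset.
Qed.

(** The block maximizes [mass] among those extending it within [A].  Merging it
    with a nonempty block of other indices of [A] whose disc touches its own
    would increase the mass.  If 0 is available, it has to be in the block, as
    only one of two merging discs may be the complement of a closed disc. *)
Lemma maximal_block A k : A `<=` S -> A k -> (A 0%N -> k = 0%N) ->
  exists B c s, [/\ B k, B `<=` A, block (k == 0%N) B c s &
    forall B' c' s', B' `<=` A `\` B -> B' !=set0 -> block false B' c' s' ->
      closure (gdisc (k == 0%N) c s) `&` closure (gdisc false c' s') = set0].
Proof.
move=> AS Ak A0; set b := k == 0%N.
pose P (x : set nat * (C * R)) :=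
  [/\ x.1 k, x.1 `<=` A & block b x.1 x.2.1 x.2.2].
pose T := {x | P x}.
pose le (x y : T) := (sval x).1 `<=` (sval y).1 /\
  dist (sval x).2.1 (sval y).2.1 <= (sval y).2.2 - (sval x).2.2.
pose m (x : T) := mass (sval x).1.
have TS (x : T) : (sval x).1 `<=` S.
  by have [_ xA _] := svalP x; exact: subset_trans AS.
have [c [s bk]] := block1 (AS _ Ak).
have Pk : P ([set k], (c, s)) by split=> // _ ->.
have lexx x : le x x by split=> //; rewrite distxx subrr.
have letr x y z : le x y -> le y z -> le x z.
  move=> [xy1 xy2] [yz1 yz2]; split; first exact: subset_trans yz1.
  by apply: le_trans (dist_triangle (sval y).2.1 _ _) _; lra.
have mono x y : le x y -> m x <= m y.
  by move=> [xy _]; apply: massS.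
have bound x : m x <= mass S by apply: massS.
have ub (u : nat -> T) : (forall n, le (u n) (u n.+1)) ->
    exists z, forall n, le (u n) z.
  move=> incu.
  have [a [t [ca bt]]] := @block_limit b (fun n => (sval (u n)).1)
    (fun n => (sval (u n)).2.1) (fun n => (sval (u n)).2.2)
    (fun n => let: And3 _ _ x := svalP (u n) in x)
    (fun n => (incu n).1) (fun n => (incu n).2).
  have Pz : P (\bigcup_n (sval (u n)).1, (a, t)).
    split=> //; first by exists 0%N => //; case: (svalP (u 0%N)).
    by move=> j [n _]; have [_ + _] := svalP (u n); apply.
  by exists (exist _ _ Pz) => n; split; [move=> i Bi; exists n|exact: ca].
have [[[B [c1 s1]] /= [Bk BA bB]] _ maxB] :=
  exists_maximal lexx letr mono bound ub (exist _ _ Pk).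
exists B, c1, s1; split=> // B' c' s' B'A [j B'j] bB'.
apply/seteqP; split=> // z meet.
have BB' : B `&` B' = set0.
  by apply/seteqP; split=> // i [Bi /B'A[]].
have [w c1w bBB'] := block_merge bB bB' BB' (ex_intro _ z meet).
have PU : P (B `|` B', (w, s1 + s')).
  by split=> //=; [left|move=> i [/BA|/B'A[]]].
have /maxB : le (exist _ _ (And3 Bk BA bB) : T) (exist _ _ PU).
  by split=> [i ?|]; [left|rewrite /= addrAC subrr add0r].
have [B'S B'0 _ _ _] := bB'.
have j0 : j <> 0%N by move=> j0; rewrite j0 in B'j; have /B'0 := B'j.
have := mass_gt0 B'S B'j j0.
rewrite /m /= massU //; last by move=> i [/BA/AS|/B'S].
lra.
Qed.

(** The block [B n] is chosen at stage [n] when [n] is an index not in an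
    earlier block and is empty otherwise, so that [B n n] tells whether stage
    [n] produced one. *)
Lemma block_partition :
  exists (B : nat -> set nat) (c : nat -> C) (s : nat -> R),
  [/\ B 0%N 0%N, trivIset setT B, \bigcup_(n in [set n | B n n]) B n = S,
      forall n, B n n -> block (n == 0%N) (B n) (c n) (s n) &
      forall i j, B i i -> B j j -> i <> j ->
        closure (gdisc (i == 0%N) (c i) (s i)) `&`
        closure (gdisc (j == 0%N) (c j) (s j)) = set0].
Proof.
pose good (p : nat * set nat) :=
  [/\ p.2 `<=` S, p.2 p.1 & p.2 0%N -> p.1 = 0%N].
pose isolated A b c s := forall B' c' s', B' `<=` A -> B' !=set0 ->
  block false B' c' s' ->
  closure (gdisc b c s) `&` closure (gdisc false c' s') = set0.
have pick (p : nat * set nat) : exists x : set nat * (C * R),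
    (good p -> [/\ x.1 p.1, x.1 `<=` p.2,
       block (p.1 == 0%N) x.1 x.2.1 x.2.2 &
       isolated (p.2 `\` x.1) (p.1 == 0%N) x.2.1 x.2.2]) /\
    (~ good p -> x.1 = set0).
  have [gp|ngp] := pselect (good p); last by exists (set0, (0, 0)).
  have [pS pp p0] := gp.
  have [B [c [s Bcs]]] := maximal_block pS pp p0.
  by exists (B, (c, s)).
have {pick} [f fP] := choice pick.
(* A n is what the blocks chosen before stage n leave available. *)
pose A n := iteri n (fun i A => A `\` (f (i, A)).1) S.
pose x n := f (n, A n).
have AS n : A n.+1 = A n `\` (x n).1 by [].
have decA i j : (i <= j)%N -> A j `<=` A i.
  elim: j => [|j IH]; first by rewrite leqn0 => /eqP->.
  rewrite leq_eqVlt => /predU1P[->//|]; rewrite ltnS => /IH.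
  by move=> ji; rewrite AS => n [/ji].
have good0 : good (0%N, A 0%N) by split=> //; exact: da_dom0.
have x00 : (x 0%N).1 0%N by have [] := (fP _).1 good0.
have goodA n : A n n -> good (n, A n).
  move=> An; split=> //; first exact: (decA 0%N).
  by case: n An => // n _ /(decA 1%N n.+1 isT)[].
have goodx n m : (x n).1 m -> good (n, A n).
  move=> xm; apply: contrapT => /(fP _).2.
  by move=> xn; rewrite /x xn in xm.
have xA n : (x n).1 `<=` A n.
  by move=> m xm; have [_ + _ _] := (fP _).1 (goodx _ _ xm); apply.
have xnn n m : (x n).1 m -> (x n).1 n.
  by move=> /goodx/(fP _).1[].
have sep i j : (i < j)%N -> (x j).1 `<=` A i `\` (x i).1.
  by move=> ij m /xA/(decA i.+1 j ij).
have iso i j : (i < j)%N -> (x i).1 i -> (x j).1 j ->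
    closure (gdisc (i == 0%N) (x i).2.1 (x i).2.2) `&`
    closure (gdisc (j == 0%N) (x j).2.1 (x j).2.2) = set0.
  move=> ij /goodx/(fP _).1[_ _ _ isoi] xj.
  have /(fP _).1[_ _ + _] := goodx _ _ xj.
  have -> : (j == 0%N) = false by case: j ij {xj}.
  by apply: isoi; [exact: sep|exists j].
exists (fun n => (x n).1), (fun n => (x n).2.1), (fun n => (x n).2.2).
split=> //.
- apply/trivIsetP => i j _ _; rewrite neq_lt => ij.
  apply/seteqP; split=> // m [xi xj].
  by case/orP: ij => /sep; [move=> /(_ m xj)[]|move=> /(_ m xi)[]].
- apply/seteqP; split=> [m [n _ /xA/(decA 0%N n (leq0n n))]//|k Sk].
  (* Either k was taken before stage k, or it is available at that stage. *)
  have [xk|nxk] := pselect (exists2 n, (n < k)%N & (x n).1 k).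
    by have [n _ xnk] := xk; exists n => //=; exact: xnn xnk.
  suff Ak : A k k by have [xkk _ _ _] := (fP _).1 (goodA _ Ak); exists k.
  have : forall n, (n <= k)%N -> A n k; last exact.
  elim=> // n IH nk; rewrite AS; split; first by apply: IH; exact: ltnW.
  by move=> xk; apply: nxk; exists n.
- by move=> n /goodx/(fP _).1[].
- move=> i j xi xj /eqP; rewrite neq_lt => /orP[ij|ji]; first exact: iso.
  by rewrite setIC; exact: iso.
Qed.

End blocks.

(** * Classicalization *)

Local Open Scope ereal_scope.

Theorem theorem4p1p9 (R : realType) (h : disc_assignment R) :
  feinstein_heath h ->
  exists h' : disc_assignment R,
    [/\ classical h', feinstein_heath h',
        swiss_cheese_set h' `<=` swiss_cheese_set h & delta h <= delta h'].
Proof.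
move=> hFH.
have [B [c [s [B00 trivB covB blB isoB]]]] := block_partition hFH.
pose S' := [set n | B n n].
pose d n := gdisc (n == 0%N) (c n) (s n).
have s_neg : (s 0%N < 0)%R by have [] := blB _ B00.
have s_pos n : S' n -> n <> 0%N -> (0 < s n)%R.
  by move=> Sn /eqP/negPf n0; have [_ _ + _ _] := blB _ Sn; rewrite n0.
have dE n : n <> 0%N -> d n = open_disc (c n) (s n).
  by rewrite /d => /eqP/negPf ->.
have d0E : ~` d 0%N = closed_disc (c 0%N) (- s 0%N) by rewrite /d /= setCK.
have d_open n : (S' `\ 0%N) n -> is_open_disc (d n).
  move=> [Sn n0]; exists (c n), (s n); split; [exact: s_pos|exact: dE].
have d_codom : set_fun S' discs_and_codiscs d.
  move=> n Sn; have [->|n0] := pselect (n = 0%N); last by left; apply: d_open.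
  by right; exists (c 0%N), (- s 0%N)%R; rewrite oppr_gt0.
have d_cheese : is_swiss_cheese (~` d 0%N) (d @` (S' `\ 0%N)).
  split.
  - by exists (c 0%N), (- s 0%N)%R; rewrite oppr_gt0.
  - exact: card_le_trans (card_image_le _ _) (countableP _).
  - by move=> _ [n Sn <-]; exact: d_open.
pose h' := @DiscAssignment R S' d B00 d_codom d_cheese.
have R'E : radius (~` h' 0%N) = (- s 0%N)%R.
  by rewrite [h' 0%N]/(d 0%N) d0E closed_disc_radius // oppr_gt0.
have BS n : S' n -> B n `<=` da_dom h by move=> /blB[].
have B0S := BS _ B00.
(* Only the radii of indices outside B 0 contribute: the rest of the mass has
   been taken off the radius of the bounding disc. *)
have sum' : sum_radii h' <= (mass h (da_dom h `\` B 0%N))%:E.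
  rewrite -(massE hFH) //.
  apply: (@le_trans _ _
    (\esum_(n in S' `\ 0%N) \esum_(j in B n) (radius (h j))%:E)).
    apply: le_esum => n [Sn n0].
    have -> : radius (h' n) = s n.
      rewrite [LHS](congr1 radius (dE n n0)) open_disc_radius //.
      exact: s_pos.
    have [BnS Bn0 _ _ snB] := blB _ Sn.
    rewrite (negPf (introN eqP n0)) subr0 in snB.
    have -> : B n = B n `\ 0%N.
      apply/seteqP; split=> m; last by case.
      move=> Bm; split=> // m0; move: Bm; rewrite m0 => /Bn0.
      by rewrite (negPf (introN eqP n0)).
    by rewrite (massE hFH) // lee_fin.
  rewrite -esum_bigcupT //; last by move=> n; rewrite lee_fin radius_ge0.
  apply: esum_subset => [n|m [n [Sn n0] Bm]].
    by rewrite lee_fin radius_ge0.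
  have nB0 : ~ B 0%N m.
    by move=> B0m; apply: n0; apply: (trivB n 0%N) => //; exists m.
  split; first by split=> //; exact: BS Bm.
  by move=> m0; apply: nB0; rewrite m0.
have massS_split : mass h (da_dom h) =
    (mass h (B 0%N) + mass h (da_dom h `\` B 0%N))%R.
  by rewrite -massU ?setDUK // setDIK.
have [_ _ _ _ s0B] := blB _ B00; rewrite eqxx in s0B.
have ltS := mass_lt hFH.
have FH' : feinstein_heath h'.
  apply: le_lt_trans sum' _; rewrite R'E lte_fin.
  by rewrite massS_split in ltS; lra.
exists h'; split=> //.
- split; last by apply: lt_trans FH' _; exact: ltry.
  by move=> i j Si Sj ij; exact: isoB.
- apply: subsetC => z [k Sk hz].
  have : (\bigcup_(n in S') B n) k by rewrite covB.
  move=> [n Sn Bk]; exists n => //.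
  by have [_ _ _ /(_ k Bk) + _] := blB _ Sn; apply.
- rewrite /delta R'E [sum_radii h]massE //.
  apply: (@le_trans _ _ ((- s 0%N)%:E - (mass h (da_dom h `\` B 0%N))%:E)).
    rewrite -!EFinB lee_fin massS_split; lra.
  exact: leeB.
Qed.
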